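(* Let $M$ be a countable structure, let $G \leq \mathrm{Sym}(M)$ be a Polish group, and let $n \geq 1$. The following are equivalent: (1) $\mathcal{K}_{G,n}$ has the joint embedding property (JEP) and the weak amalgamation property (WAP); (2) there are $\Phi_1, \ldots, \Phi_n \in G$ such that $(\Phi_1, \ldots, \Phi_n)$ is weakly $\mathcal{K}_{G,n}$-injective; (3) there are $\Phi_1, \ldots, \Phi_n \in G$ such that Odd has a winning strategy in the game $BM_p(G, \Phi_1, \ldots, \Phi_n)$; (4) $G$ has a comeager $n$-diagonal conjugacy class.
   Context: $M$ is a countable first-order structure and $G\le \mathrm{Sym}(M)$ is a group of permutations of $M$ which is Polish in the topology of pointwise convergence (inherited from the product topology on $M^M$). A map $S:A\to B$ between substructures of $M$ is $G$-extendable if some $g\in G$ extends it. For a map $f$, $\mathrm{zdef}(f)=\mathrm{dom}(f)\cup\mathrm{rng}(f)$. $\mathcal{K}_{G,n}$ is the family of all $n$-tuples $\bar S=(S_1,\dots,S_n)$ where each $S_i$ is a $G$-extendable bijection between finitely generated substructures of $M$. For $n$-tuples $\bar S,\bar T$ of partial maps on $M$, an embedding of $\bar S$ into $\bar T$ is a $G$-extendable injection $\phi$ whose domain is a substructure of $M$ containing $\bigcup_i\mathrm{zdef}(S_i)$, such that $\phi\circ S_i\subseteq T_i\circ\phi$ for all $i$ (i.e. $\phi(S_i(x))=T_i(\phi(x))$ for $x\in\mathrm{dom}(S_i)$); it is an isomorphism if $\phi\circ S_i=T_i\circ\phi$ for all $i$. We write $\bar S\le\bar T$ if $S_i\subseteq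 T_i$ (as graphs) for every $i$. $\sigma\mathcal{K}_{G,n}$ is the family of componentwise unions $\bigcup_k \bar S^k$ of chains $\bar S^0\le\bar S^1\le\cdots$ in $\mathcal{K}_{G,n}$; embeddings, isomorphisms and $\le$ are defined for them in the same way. JEP: for all $\bar S,\bar T\in\mathcal{K}_{G,n}$ there are $\bar U\in\mathcal{K}_{G,n}$ and embeddings of $\bar S$ and of $\bar T$ into $\bar U$. WAP: for every $\bar S\in\mathcal{K}_{G,n}$ there are $\bar T\in\mathcal{K}_{G,n}$ and an embedding $\tau$ of $\bar S$ into $\bar T$ such that for all $\bar U,\bar V\in\mathcal{K}_{G,n}$ and embeddings $\phi:\bar T\to\bar U$, $\psi:\bar T\to\bar V$ there are $\bar W\in\mathcal{K}_{G,n}$ and embeddings $\phi':\bar U\to\bar W$, $\psi':\bar V\to\bar W$ with $\phi'\circ\phi\circ\tau=\psi'\circ\psi\circ\tau$ on $\bigcup_i\mathrm{zdef}(S_i)$. An element $\bar\Phi\in\sigma\mathcal{K}_{G,n}$ is $\mathcal{K}_{G,n}$-universal if every element of $\mathcal{K}_{G,n}$ embeds into $\bar\Phi$; it is weakly $\mathcal{K}_{G,n}$-injective if it is $\mathcal{K}_{G,n}$-universal and for every $\bar S\in\mathcal{K}_{G,n}$ with $\bar S\le\bar\Phi$ there is $\bar T\in\mathcal{K}_{G,n}$ with $\bar S\le\bar T\le\bar\Phi$ such that for every $\bar U\in\mathcal{K}_{G,n}$ with $\bar T\le\bar U$ there is an embedding $\phi:\bar U\to\bar\Phi$ which is the identity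 on $\bigcup_i\mathrm{dom}(S_i)$. The game $BM_p(G,\Phi_1,\dots,\Phi_n)$: players Eve and Odd alternately choose elements of $\mathcal{K}_{G,n}$, Eve starting with $\bar S^0$, then Odd choosing $\bar S^1\ge\bar S^0$, Eve $\bar S^2\ge\bar S^1$, etc.; Odd wins if $\bigcup_k\bar S^k$ is isomorphic to $(\Phi_1,\dots,\Phi_n)$. An $n$-diagonal conjugacy class in $G$ is a set $\{(g^{-1}g_1g,\dots,g^{-1}g_ng):g\in G\}\subseteq G^n$ for some $(g_1,\dots,g_n)\in G^n$; comeager refers to the product topology on $G^n$.
   Formalization: The equivalence is proved when every element of G commutes with the functions and fixes the constants of M (automatic if M is relational or G ≤ Aut(M)); for arbitrary G ≤ Sym(M) on a structure with function symbols it can fail. *)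

(* Defs.v *)
From HB Require Import structures.
From mathcomp Require Import all_boot all_order all_algebra.
From mathcomp Require Import all_classical all_reals all_analysis.

Set Implicit Arguments.
Unset Strict Implicit.
Unset Printing Implicit Defensive.

Import Order.TTheory GRing.Theory Num.Theory.

Local Open Scope classical_set_scope.

(** * Topological notions *)

Definition separable_space (T : topologicalType) : Prop :=
  exists2 D : set T, countable D & dense D.

(* Homeomorphic to a complete metric space.  [Complete] of the library is
   not used because it requires a pointed type. *)
Definition completely_metrizable (R : realType) (T : topologicalType) : Prop :=
  exists (X : metricType R) (f : T -> X) (g : X -> T),
    [/\ cancel f g, cancel g f, continuous f, continuous g &
        forall F : set_system X, ProperFilter F -> cauchy F ->
          exists x : X, F --> x].

Definition polish (R : realType) (T : topologicalType) : Prop :=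
  separable_space T /\ completely_metrizable R T.

Definition comeager (T : topologicalType) (A : set T) : Prop :=
  exists2 U : (set T)^nat,
    (forall k, open (U k) /\ dense (U k)) & \bigcap_k U k `<=` A.

(** * First-order structures *)

Record language := Language {
  fsym : Type;
  farity : fsym -> nat;
  rsym : Type;
  rarity : rsym -> nat
}.

(* Constants are the function symbols of arity 0. *)
Record structure (L : language) (M : Type) := Structure {
  finterp : forall f : fsym L, ('I_(farity f) -> M) -> M;
  rinterp : forall r : rsym L, ('I_(rarity r) -> M) -> Prop
}.

(* The empty set is a substructure when there are no constants. *)
Definition substructure (L : language) (M : Type) (mm : structure L M)
    (A : set M) : Prop :=
  forall (f : fsym L) (v : 'I_(farity f) -> M),
    (forall i, A (v i)) -> A (finterp mm v).

Definition fg_substructure (L : language) (M : Type) (mm : structure L M)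
    (A : set M) : Prop :=
  exists2 B : set M, finite_set B & A = smallest (substructure mm) B.

(** * Permutation groups *)

(* M^M with the product topology, M being discrete.  A subset
   [G : set (selfmaps M)], used as a type, carries the subspace topology. *)
Definition selfmaps (M : countType) : topologicalType :=
  {ptws M -> discrete_topology M}.

Definition perm_group (M : countType) (G : set (selfmaps M)) : Prop :=
  [/\ forall g, G g -> bijective g,
      G id,
      forall g h, G g -> G h -> G (g \o h) &
      forall g h, G g -> cancel g h -> cancel h g -> G h].

(* Every element of G is an automorphism of the algebraic reduct of M.  This
   holds for every G if there are no function symbols, and for every group of
   automorphisms of M.  Without it the elements of G need not map
   substructures to substructures, and tuples of maps between finitely
   generated substructures need not describe a basis of the topology of G^n. *)
Definition preserves_operations (L : language) (M : countType)
    (mm : structure L M) (G : set (selfmaps M)) : Prop :=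
  forall g, G g -> forall (f : fsym L) (v : 'I_(farity f) -> M),
    g (finterp mm v) = finterp mm (g \o v).

(** * Tuples of partial maps *)

(* A partial map on M is identified with its graph; composition of partial
   maps is composition of relations, [B \; A] being "A, then B". *)
Definition graph (M : Type) (g : M -> M) : set (M * M) :=
  [set p | p.2 = g p.1].

Definition zdef (M : Type) (S : set (M * M)) : set M := S.`1 `|` S.`2.

Definition ptuple (n : nat) (M : Type) : Type := 'I_n -> set (M * M).

Definition tuple_le (n : nat) (M : Type) (S T : ptuple n M) : Prop :=
  forall i, S i `<=` T i.

Definition zdefs (n : nat) (M : Type) (S : ptuple n M) : set M :=
  \bigcup_i zdef (S i).

(* When G consists of bijections, such an S is the graph of an injective
   partial map, i.e. of a bijection from S.`1 onto S.`2. *)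
Definition extendable (M : countType) (G : set (selfmaps M))
    (S : set (M * M)) : Prop :=
  exists2 g, G g & S `<=` graph g.

Section Tuples.
Variables (L : language) (M : countType) (mm : structure L M).
Variables (G : set (selfmaps M)) (n : nat).
Implicit Types S T U V W : ptuple n M.

Definition inK S : Prop :=
  forall i, [/\ extendable G (S i), fg_substructure mm (S i).`1 &
                fg_substructure mm (S i).`2].

Definition embedding (phi : set (M * M)) S T : Prop :=
  [/\ extendable G phi, substructure mm phi.`1, zdefs S `<=` phi.`1 &
      forall i, ((phi \; S i) `<=` (T i \; phi))%relation].

Definition isomorphism (phi : set (M * M)) S T : Prop :=
  embedding phi S T /\ forall i, ((phi \; S i) = (T i \; phi))%relation.

Definition isomorphic S T : Prop := exists phi, isomorphism phi S T.

Definition chain (s : nat -> ptuple n M) : Prop :=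
  (forall k, inK (s k)) /\ (forall k, tuple_le (s k) (s k.+1)).

Definition chain_union (s : nat -> ptuple n M) : ptuple n M :=
  fun i => \bigcup_k s k i.

Definition in_sigmaK S : Prop := exists2 s, chain s & S = chain_union s.

Definition JEP : Prop :=
  forall S T, inK S -> inK T ->
  exists2 U, inK U &
    (exists phi, embedding phi S U) /\ (exists psi, embedding psi T U).

Definition WAP : Prop :=
  forall S, inK S ->
  exists T tau, [/\ inK T, embedding tau S T &
    forall U V phi psi, inK U -> inK V ->
      embedding phi T U -> embedding psi T V ->
    exists W phi' psi', [/\ inK W, embedding phi' U W, embedding psi' V W &
      forall x, zdefs S x -> forall y,
        (phi' \; (phi \; tau))%relation (x, y) <->
        (psi' \; (psi \; tau))%relation (x, y)]].

Definition universal Phi : Prop :=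
  in_sigmaK Phi /\ forall S, inK S -> exists phi, embedding phi S Phi.

Definition weakly_injective Phi : Prop :=
  universal Phi /\
  forall S, inK S -> tuple_le S Phi ->
  exists T, [/\ inK T, tuple_le S T, tuple_le T Phi &
    forall U, inK U -> tuple_le T U ->
    exists2 phi, embedding phi U Phi &
      forall i x, (S i).`1 x -> phi (x, x)].

(* A strategy of Odd maps a finite play s_0 <= ... <= s_2k, in which it is
   Odd's turn, to Odd's next move s_(2k+1).  It is winning if its answers are
   legal and Odd wins every play in which all the odd moves follow it. *)
Definition odd_winning_strategy Phi (sigma : seq (ptuple n M) -> ptuple n M) :
    Prop :=
  (forall (s : nat -> ptuple n M) (k : nat),
     (forall j, (j <= k.*2)%N -> inK (s j)) ->
     (forall j, (j < k.*2)%N -> tuple_le (s j) (s j.+1)) ->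
     inK (sigma (mkseq s k.*2.+1)) /\
     tuple_le (s k.*2) (sigma (mkseq s k.*2.+1))) /\
  (forall s : nat -> ptuple n M, chain s ->
     (forall k, s k.*2.+1 = sigma (mkseq s k.*2.+1)) ->
     isomorphic (chain_union s) Phi).

Definition odd_wins_BM Phi : Prop :=
  exists sigma, odd_winning_strategy Phi sigma.

End Tuples.

Definition graphs (M : countType) (G : set (selfmaps M)) (n : nat)
    (Phi : 'I_n -> G) : ptuple n M :=
  fun i => graph (\val (Phi i) : M -> M).

Definition diagonal_class (M : countType) (G : set (selfmaps M)) (n : nat)
    (g : 'I_n -> G) : set {ptws 'I_n -> G} :=
  [set h | exists k k' : M -> M,
     [/\ G k, cancel k k', cancel k' k &
         forall i, \val (h i) = k' \o (\val (g i) : M -> M) \o k]].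

(* Main.v *)
(* An embedding is the restriction of some [a] in [G], so that embedding [S]
   into [T] means [S <= a^-1 T a], and the boxes of all tuples in [G^n]
   extending some [S] in [K], of which there are countably many, form a basis of the
   topology of [G^n].  A Polish group of permutations is closed in Sym(M); hence
   a chain in [K] with total and surjective union converges in [G^n], and a
   tuple in [G^n] can meet countably many density requirements.

   - (1) => (2): universality and the existence of weak amalgamation witnesses
     and of the required embeddings are countably many requirements, which are
     dense by JEP and WAP.
   - (2) => (3): Odd keeps the current position embedded in [Phi] and extends
     the embedding back and forth; the limit is an element of [G] conjugating
     the outcome of the game to [Phi].
   - (3) => (4): for each of the countably many finite plays following the
     strategy, the tuples extending the next move of Odd for some move of Eve
     form a dense open set (inside the box of the play); a tuple in all of them
     is the outcome of a play won by Odd.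
   - (4) => (1): any two boxes meet the class, which yields JEP.  The class is a
     countable union of sets of conjugates of [g] by elements with prescribed
     values on generators of [S]; one of them is dense in the box of some
     [T >= S], and two such elements amalgamate extensions of [T] over [S]. *)

Require Import Defs.
From HB Require Import structures.
From mathcomp Require Import all_boot all_order all_algebra.
From mathcomp Require Import all_classical all_reals all_analysis.
From mathcomp Require Import zify.

Set Implicit Arguments.
Unset Strict Implicit.
Unset Printing Implicit Defensive.

Import Order.TTheory GRing.Theory Num.Theory.

Local Open Scope classical_set_scope.

(** Dependent choice in which [P] also sees the step number, so that step [k] can take care of the
    [k]-th item of an enumeration. *)
Lemma indexed_choice (T : Type) (I : T -> Prop) (P : nat -> T -> T -> Prop) x0 :
  I x0 -> (forall k x, I x -> exists2 y, I y & P k x y) ->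
  exists u : nat -> T, u 0%N = x0 /\ forall k, I (u k) /\ P k (u k) (u k.+1).
Proof.
move=> I0 IP.
have /choice [F FP] : forall kx : nat * T, exists y : T,
    I kx.2 -> I y /\ P kx.1 kx.2 y.
  move=> [k x] /=; have [/(IP k)[y Iy Py]|nIx] := pselect (I x).
    by exists y.
  by exists x0.
pose u := fix u k := if k is k'.+1 then F (k', u k') else x0.
exists u; split=> // k.
have Iu : I (u k) by elim: k => //= k /(FP (k, _))[].
by split=> //; have /= [] := FP (k, u k) Iu.
Qed.

(** * Pointwise convergence in [G] and in [G^n] *)

Section SelfmapsTopology.
Variables (M : countType) (G : set (selfmaps M)).

Definition bundle (a : M -> M) (Ga : G a) : G := exist _ a (mem_set Ga).

Lemma selfmaps_nbhs (a : selfmaps M) (O : set (selfmaps M)) :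
  nbhs a O -> exists B : seq M, forall x : M -> M, {in B, x =1 a} -> O x.
Proof.
pose F := filter_from [set: seq M]
  (fun B => [set x : selfmaps M | {in B, x =1 a}]).
have FF : Filter F.
  apply: filter_from_filter; first by exists [::].
  move=> B C _ _; exists (B ++ C) => // x xBC; split=> m mB; apply: xBC;
    by rewrite mem_cat mB ?orbT.
suff : F --> a by move=> /[apply] -[B _ BO]; exists B => x /BO.
apply/cvg_sup => m O1 [_ [[W _ <-]] Wa WO].
exists [:: m] => //= x xa; apply: WO => /=.
by rewrite xa // mem_seq1.
Qed.

Lemma subgroup_nbhs (a : G) (O : set G) :
  nbhs a O ->
  exists B : seq M, forall x : G, {in B, val x =1 val a} -> O x.
Proof.
case=> _ [[W oW <-] Wa WO].
have /selfmaps_nbhs[B BW] : nbhs (\val a) W by exact: open_nbhs_nbhs.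
by exists B => x /BW ?; apply: WO.
Qed.

Lemma evaluation_nbhs (a : G) (m : M) : nbhs a [set x : G | val x m = val a m].
Proof.
apply: (@initial_continuous _ _ (\val : G -> selfmaps M) a
  [set x : selfmaps M | x m = val a m]).
apply: (@proj_continuous M (fun=> discrete_topology M) m (val a) [set val a m]).
exact: (@discrete_set1 (discrete_topology M)).
Qed.

Lemma tuple_nbhs (n : nat) (h : {ptws 'I_n -> G}) (O : set {ptws 'I_n -> G}) :
  nbhs h O -> exists B : seq M, forall x : 'I_n -> G,
    (forall i, {in B, val (x i) =1 val (h i)}) -> O x.
Proof.
pose F := filter_from [set: seq M]
  (fun B => [set x : {ptws 'I_n -> G} |
    forall i, {in B, val (x i) =1 val (h i)}]).
have FF : Filter F.
  apply: filter_from_filter; first by exists [::].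
  move=> B C _ _; exists (B ++ C) => // x xBC; split=> i m mB; apply: xBC;
    by rewrite mem_cat mB ?orbT.
suff : F --> h by move=> /[apply] -[B _ BO]; exists B => x /BO.
apply/cvg_sup => i O1 [_ [[W oW <-]] Wa WO].
have /subgroup_nbhs[B BW] : nbhs (h i) W by exact: open_nbhs_nbhs.
by exists B => //= x xa; apply: WO => /=; apply: BW; exact: xa.
Qed.

Lemma tuple_evaluation_nbhs (n : nat) (h : {ptws 'I_n -> G}) (B : seq M) :
  nbhs h [set x | forall i, {in B, val (x i) =1 val (h i)}].
Proof.
pose agree i := [set x : {ptws 'I_n -> G} | {in B, val (x i) =1 val (h i)}].
apply: (@filter_forall _ _ agree (nbhs h)) => i; rewrite {}/agree.
elim: B => [|m B IH].
  by apply: filterS (@filterT _ (nbhs h) _) => x _.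
have mh : nbhs h [set x : {ptws 'I_n -> G} | val (x i) m = val (h i) m].
  exact: (@proj_continuous 'I_n (fun=> G) i h _ (evaluation_nbhs (h i) m)).
apply: filterS2 IH mh => x xB xm m'; rewrite inE => /orP[/eqP->//|]; exact: xB.
Qed.


End SelfmapsTopology.

(** * Completely metrizable permutation groups are closed in [Sym(M)] *)

Section Closed.
Variables (R : realType) (M : countType) (G : set (selfmaps M)).
Hypothesis hG : perm_group G.

(* Two Cauchy sequences [a_k] and [b_k] in [G] with [b_k = p \o a_k] on larger
   and larger finite sets are built simultaneously; their limits [a] and [b]
   satisfy [p = b \o a^-1]. *)
Lemma complete_perm_group_closed (p q : M -> M) :
  completely_metrizable R G -> cancel p q -> cancel q p ->
  (forall B : seq M, exists2 a, G a & {in B, a =1 p}) -> G p.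
Proof.
move=> [X [f [g [fg gf cf cg cX]]]] pq qp loc.
have [Gbij Gid Gcomp Ginv] := hG.
have small (a : G) (k : nat) : exists B : seq M, forall x : G,
    {in B, val x =1 val a} -> ball (f a) k.+1%:R^-1 (f x).
  by apply: subgroup_nbhs; apply: cf; apply: nbhsx_ballx.
(* Such a sequence is Cauchy in the complete space [X]; its limit is carried back by [g], and values
   at a point [m] stabilise because [M] is discrete. *)
have limit (a : nat -> G) :
    (forall k l, (k < l)%N -> ball (f (a k)) k.+1%:R^-1 (f (a l))) ->
    exists b : G, forall m, exists N, forall l, (N <= l)%N ->
      val (a l) m = val b m.
  move=> aC; have [] := cX ((f \o a) @ \oo).
    apply: cauchy_exP => e e0.
    have [k _ ke] := near_infty_natSinv_lt (PosNum e0).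
    exists (f (a k)); exists k.+1 => // l /= kl.
    by apply: (@le_ball _ _ _ k.+1%:R^-1); [exact/ltW/ke/leqnn|exact: aC].
  move=> x ax; exists (g x) => m.
  have : a @ \oo --> g x.
    have -> : a = g \o (f \o a) by apply/funext => l /=; rewrite fg.
    by move=> O /(cg x) gO; exact: (ax _ gO).
  by move=> /(_ _ (evaluation_nbhs (g x) m))[N _ NP]; exists N => l /NP.
pose x0 : G := bundle Gid.
(* A state is [(a, B, b)]. The last two clauses keep later maps near the old [a] and near the new
   [b]: the new [b] is made from the old [a], and the new [a] from the new [b]. *)
pose P k (s s' : G * seq M * G) :=
  [/\ {subset s.1.2 <= s'.1.2} /\
        (forall m, unpickle k = Some m -> m \in s'.1.2),
      {in s.1.2, val s'.1.1 =1 val s.1.1},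
      {in s'.1.2, forall m, p (val s'.1.1 m) = val s'.2 m},
      forall x : G, {in s'.1.2, val x =1 val s'.1.1} ->
        ball (f s.1.1) k.+1%:R^-1 (f x) &
      forall x : G, {in s'.1.2, val x =1 val s'.2} ->
        ball (f s'.2) k.+1%:R^-1 (f x)].
have Gval (x : G) : G (val x) by apply: set_mem; exact: valP.
have step k s : True -> exists2 s', True & P k s s'.
  move: s => [[a B] b0] _; have [B1 B1P] := small a k.
  pose C := B ++ B1 ++ seq_of_opt (unpickle k).
  have [c Gc cP] := loc (map (val a) C).
  pose b : G := bundle (Gcomp _ _ Gc (Gval a)).
  have [B2 B2P] := small b k; pose B' := C ++ B2.
  (* [d] acts as [p] on [q (b m)], so it sends this point to [b m]; hence [a' = d' \o b] satisfies
     [p (a' m) = b m] on [B']. *)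
  have [d Gd dP] := loc (map (q \o val b) B').
  have [d' dd' d'd] := Gbij _ Gd.
  have Gd' : G d' by exact: Ginv dd' d'd.
  pose a' : G := bundle (Gcomp _ _ Gd' (Gval b)).
  have pa' : {in B', forall m, p (val a' m) = val b m}.
    move=> m mB'; have E : d (q (val b m)) = val b m.
      by rewrite -{2}(qp (val b m)); apply: dP; apply: map_f.
    by rewrite -[val a' m]/(d' (val b m)) -{1}E dd' qp.
  have a'a : {in C, val a' =1 val a}.
    move=> m mC; apply: (can_inj pq); rewrite pa'; last by rewrite mem_cat mC.
    by apply: cP; apply: map_f.
  exists (a', B', b) => //; rewrite /P /=; split.
  - split=> m mB; rewrite !mem_cat mB //=.
    by rewrite inE eqxx !orbT.
  - by move=> m mB; apply: a'a; rewrite !mem_cat mB.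
  - exact: pa'.
  - move=> x xa; apply: B1P => m mB1.
    by transitivity (val a' m); [apply: xa|apply: a'a];
      rewrite !mem_cat mB1 !orbT.
  - by move=> x xb; apply: B2P => m mB2; apply: xb; rewrite !mem_cat mB2 !orbT.
have [u [_ uP]] := @indexed_choice _ (fun=> True) _ (x0, [::], x0) I step.
(* The shift is due to [b k] being chosen in step [k], together with [a k.+1]. *)
pose a k := (u k).1.1; pose B k := (u k).1.2; pose b k := (u k.+1).2.
have subB k l : (k <= l)%N -> {subset B k <= B l}.
  elim: l => [|l IH]; first by rewrite leqn0 => /eqP->.
  rewrite leq_eqVlt => /orP[/eqP->//|/IH kl] m /kl.
  by have [_ [[+ _] _ _ _ _]] := uP l; apply.
have aB k l : (k <= l)%N -> {in B k, val (a l) =1 val (a k)}.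
  elim: l => [|l IH]; first by rewrite leqn0 => /eqP->.
  rewrite leq_eqVlt => /orP[/eqP->//|kl] m mB.
  rewrite -IH //; have [_ [_ + _ _ _]] := uP l; apply; exact: subB mB.
have pab k : {in B k.+1, forall m, p (val (a k.+1) m) = val (b k) m}.
  by have [_ []] := uP k.
have [a' a'P] : exists a' : G, forall m, exists N, forall l, (N <= l)%N ->
    val (a l) m = val a' m.
  by apply: limit => k l kl; have [_ [_ _ _ + _]] := uP k; apply; exact: aB.
have [b' b'P] : exists b' : G, forall m, exists N, forall l, (N <= l)%N ->
    val (b l) m = val b' m.
  apply: limit => k l kl; have [_ [_ _ _ _]] := uP k; apply=> m mB.
  have kl1 : (k.+1 <= l.+1)%N by exact: leqW.
  by rewrite -(pab l) ?(aB k.+1) ?pab //; exact: subB mB.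
have pa' m : p (val a' m) = val b' m.
  have [N1 aN] := a'P m; have [N2 bN] := b'P m.
  pose N := maxn (pickle m).+1 (maxn N1 N2).
  rewrite -(aN N.+1) -?(bN N); [|lia..].
  apply: pab; apply: (@subB (pickle m).+1); first by lia.
  by have [_ [[_ + ] _ _ _ _]] := uP (pickle m); apply; rewrite pickleK.
have [c ca ac] := Gbij _ (Gval a').
rewrite (_ : p = val b' \o c).
  by apply: Gcomp; [exact: Gval|apply: (Ginv (val a') c)].
by apply/funext => m /=; rewrite -pa' ac.
Qed.

End Closed.

(** * Finitely generated partial maps, their extensions in [G], and conjugation *)

Section PartialMaps.
Variables (L : language) (M : countType) (mm : structure L M).
Variables (G : set (selfmaps M)) (n : nat).
Hypothesis hG : perm_group G.
Hypothesis hGop : preserves_operations mm G.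
Implicit Types (S T U V W : ptuple n M) (h : 'I_n -> G) (B C : seq M).

Lemma subgroup_val (a : G) : G (val a).
Proof. by apply: set_mem; exact: valP. Qed.

Lemma subgroup_id : G id. Proof. by case: hG. Qed.

Lemma subgroup_comp (a b : M -> M) : G a -> G b -> G (a \o b).
Proof. by case: hG => _ _ + _; apply. Qed.

Lemma subgroup_inv (a : M -> M) : G a ->
  exists b : M -> M, [/\ G b, cancel a b & cancel b a].
Proof.
case: hG => bij _ _ inv Ga; have [b ab ba] := bij _ Ga.
by exists b; split=> //; exact: inv ab ba.
Qed.

Lemma subgroup_inj (a : M -> M) : G a -> injective a.
Proof. by move=> /subgroup_inv[b [_ /can_inj]]. Qed.

Lemma tuple_le_refl S : tuple_le S S. Proof. by move=> i x. Qed.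

Lemma tuple_le_trans T S U : tuple_le S T -> tuple_le T U -> tuple_le S U.
Proof. by move=> ST TU i x /ST /TU. Qed.

Definition generated B : set M := smallest (substructure mm) [set` B].

Lemma generated_substructure B : substructure mm (generated B).
Proof.
by move=> f v vB A [sA BA]; apply: (sA) => i; exact: (vB i A (conj sA BA)).
Qed.

Lemma subset_generated B : [set` B] `<=` generated B.
Proof. exact: sub_gen_smallest. Qed.

Lemma generated_le B C : {subset B <= C} -> generated B `<=` generated C.
Proof.
move=> BC; apply: smallest_sub; first exact: generated_substructure.
by move=> x /BC /subset_generated.
Qed.

Lemma fg_substructureP (A : set M) :
  fg_substructure mm A <-> exists B, A = generated B.
Proof.
split=> [[X /finite_seqP[B ->] ->]|[B ->]]; first by exists B.
by exists [set` B] => //; apply/finite_seqP; exists B.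
Qed.

(** The points where two operation-preserving maps agree form a substructure. *)
Lemma eq_generated (a b : M -> M) B : G a -> G b -> {in B, a =1 b} ->
  forall x, generated B x -> a x = b x.
Proof.
move=> Ga Gb ab x.
apply: (@smallest_sub _ _ _ [set x | a x = b x]) => // f v vE.
by rewrite /= hGop // hGop //; congr finterp; apply/funext => i; exact: vE.
Qed.

Lemma generated_map (a : M -> M) B : G a ->
  generated (map a B) = a @` generated B.
Proof.
move=> Ga; have [b [Gb ab ba]] := subgroup_inv Ga.
apply/seteqP; split=> [|_ [x Bx <-]].
  apply: smallest_sub => [f v vB|_ /mapP[x xB ->]]; last first.
    by exists x => //; exact: subset_generated.
  exists (finterp mm (b \o v)).
    apply: generated_substructure => i /=; have [x Bx <-] := vB i.
    by rewrite ab.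
  by rewrite hGop //; congr finterp; apply/funext => i /=; rewrite ba.
move: x Bx; apply: smallest_sub => [f v vB /=|x xB /=].
  by rewrite hGop //; exact: generated_substructure.
by apply: subset_generated; exact: map_f.
Qed.

Lemma inK_extension S : inK mm G S -> exists h, tuple_le S (graphs h).
Proof.
move=> SK.
have /choice[h hS] : forall i, exists a : G, S i `<=` graph (val a).
  by move=> i; have [[a Ga Sa] _ _] := SK i; exists (bundle Ga).
by exists h.
Qed.

Lemma inK_generators S : inK mm G S -> exists B, zdefs S `<=` generated B.
Proof.
move=> SK.
have /choice[F FP] : forall i, exists B, zdef (S i) `<=` generated B.
  move=> i; have [_ /fg_substructureP[B BE] /fg_substructureP[C CE]] := SK i.
  exists (B ++ C); rewrite /zdef BE CE => x [Bx|Cx];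
    [move: Bx|move: Cx]; apply: generated_le => y yB;
    by rewrite mem_cat yB ?orbT.
exists (flatten (map F (enum 'I_n))) => x [i _ /FP].
apply: generated_le => y yF; apply/flatten_mapP.
by exists i => //; rewrite mem_enum.
Qed.

(** The finitely generated approximations of [h]; by [inK_generators] and [le_restriction] they are
    cofinal among the members of [K] below [graphs h]. *)
Definition restriction h B : ptuple n M :=
  fun i => [set p | generated B p.1 /\ p.2 = val (h i) p.1].

Lemma restriction_inK h B : inK mm G (restriction h B).
Proof.
move=> i; split.
- by exists (val (h i)); [exact: subgroup_val|move=> [x y] []].
- apply/fg_substructureP; exists B.
  apply/seteqP; split=> x /=; first by case=> y [].
  by exists (val (h i) x).
- apply/fg_substructureP; exists (map (val (h i)) B).
  rewrite generated_map; last exact: subgroup_val.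
  apply/seteqP; split=> [y [x [/= Bx ->]]|_ [x Bx <-]]; first by exists x.
  by exists x.
Qed.

Lemma restriction_le h B : tuple_le (restriction h B) (graphs h).
Proof. by move=> i [x y] []. Qed.

Lemma le_restriction S h B : zdefs S `<=` generated B ->
  tuple_le S (graphs h) -> tuple_le S (restriction h B).
Proof.
move=> SB Sh i [x y] Sxy; split; last exact: Sh Sxy.
by apply: SB; exists i => //; left; exists y.
Qed.

Lemma inK_compatible S T h : inK mm G S -> inK mm G T ->
  tuple_le S (graphs h) -> tuple_le T (graphs h) ->
  exists U, [/\ inK mm G U, tuple_le S U, tuple_le T U & tuple_le U (graphs h)].
Proof.
move=> /inK_generators[B SB] /inK_generators[C TC] Sh Th.
exists (restriction h (B ++ C)); split; [exact: restriction_inK| | |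
  exact: restriction_le]; apply: le_restriction => // x.
- by move=> /SB; apply: generated_le => y yB; rewrite mem_cat yB.
- by move=> /TC; apply: generated_le => y yB; rewrite mem_cat yB orbT.
Qed.

(* [pullback a S] is [a^-1 S a]; hence [a] embeds [S] into [T] exactly when
   [tuple_le S (pullback a T)]. *)
Definition pullback (a : M -> M) S : ptuple n M :=
  fun i => [set p | S i (a p.1, a p.2)].

Lemma pullback_le a S T : tuple_le S T ->
  tuple_le (pullback a S) (pullback a T).
Proof. by move=> ST i p /ST. Qed.

Lemma pullbackK a b S : cancel a b -> pullback a (pullback b S) = S.
Proof. by move=> ab; apply/funext => i; apply/funext => -[x y] /=;
  rewrite /pullback /= !ab. Qed.

Lemma pullback_inK a S : G a -> inK mm G S -> inK mm G (pullback a S).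
Proof.
move=> Ga SK i; have [b [Gb ab ba]] := subgroup_inv Ga.
have fg (A : set M) : fg_substructure mm A -> fg_substructure mm (a @^-1` A).
  move=> /fg_substructureP[B ->]; apply/fg_substructureP; exists (map b B).
  rewrite generated_map //; apply/seteqP; split=> [x Bx|_ [x Bx <-]].
    by exists (a x).
  by rewrite /= ba.
have [[g Gg Sg] fg1 fg2] := SK i; split.
- exists (b \o (g \o a)); first by do 2?[apply: subgroup_comp => //].
  by move=> [x y] /Sg; rewrite /graph /= => <-; rewrite ab.
- rewrite (_ : _.`1 = a @^-1` (S i).`1); first exact: fg.
  apply/seteqP; split=> x [y Sxy]; first by exists (a y).
  by exists (b y); rewrite /pullback /= ba.
- rewrite (_ : _.`2 = a @^-1` (S i).`2); first exact: fg.
  apply/seteqP; split=> x [y Sxy]; first by exists (a y).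
  by exists (b y); rewrite /pullback /= ba.
Qed.

Lemma embedding_graph a S T : G a -> tuple_le S (pullback a T) ->
  embedding mm G (graph a) S T.
Proof.
move=> Ga ST; split.
- by exists a.
- by move=> f v _; exists (a (finterp mm v)).
- by move=> x _; exists (a x).
- move=> i [x z] [y Sxy /=]; rewrite /graph /= => ->.
  by exists (a x) => //; exact: (ST i (x, y)).
Qed.

Lemma embedding_extension phi S T : embedding mm G phi S T ->
  exists a, [/\ G a, phi `<=` graph a, tuple_le S (pullback a T) &
    forall x, zdefs S x -> phi (x, a x)].
Proof.
move=> [[a Ga phia] _ Sphi phiST].
have phix x : zdefs S x -> phi (x, a x).
  by move=> /Sphi[y pxy]; have /= := phia _ pxy; rewrite /graph /= => <-.
exists a; split=> // i [x y] Sxy.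
have [|z pxz Tz] := phiST i (x, a y).
  exists y => //=; apply: phix; exists i => //.
  by right; exists x.
by have := phia _ pxz; rewrite /graph /= => zE; move: Tz; rewrite zE.
Qed.

(** A member of [K] is determined by finitely many pairs in its graphs whose first entries generate
    the domains, since elements of [G] that agree on generators agree on the whole domain. There are
    countably many such codes. *)
Lemma inK_countable : exists e : nat -> ptuple n M,
  forall S, inK mm G S -> exists k, e k = S.
Proof.
pose code (c : {ffun 'I_n -> seq (M * M)}) S :=
  forall i, [set` c i] `<=` S i /\ (S i).`1 = generated (map fst (c i)).
have code_uniq c S T : inK mm G S -> inK mm G T -> code c S -> code c T ->
    forall i, S i `<=` T i.
  move=> SK TK cS cT i [x y] Sxy.
  have [[a Ga Sa] _ _] := SK i; have [[b Gb Tb] _ _] := TK i.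
  have [cSi Sdom] := cS i; have [cTi Tdom] := cT i.
  have gx : generated (map fst (c i)) x by rewrite -Sdom; exists y.
  have [z Txz] : (T i).`1 x by rewrite Tdom.
  suff -> : y = z by [].
  have := Sa _ Sxy; have := Tb _ Txz; rewrite /graph /= => -> ->.
  apply: (eq_generated Ga Gb _ gx) => _ /mapP[[u v] uv ->] /=.
  by have := Sa _ (cSi _ uv); have := Tb _ (cTi _ uv); rewrite /graph /= => <-.
have code_ex S : inK mm G S -> exists c, code c S.
  move=> SK.
  have /choice[F FP] : forall i, exists s : seq (M * M),
      [set` s] `<=` S i /\ (S i).`1 = generated (map fst s).
    move=> i; have [[a Ga Sa] /fg_substructureP[B BE] _] := SK i.
    exists [seq (x, a x) | x <- B]; split.
      move=> _ /mapP[x xB ->].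
      have [y Sxy] : (S i).`1 x by rewrite BE; exact: subset_generated.
      by have := Sa _ Sxy; rewrite /graph /= => <-.
    by rewrite -map_comp BE map_id.
  by exists [ffun i => F i] => i; rewrite ffunE.
have /choice[e eP] : forall k : nat, exists S, forall c, unpickle k = Some c ->
    forall T, inK mm G T -> code c T -> S = T.
  move=> k; case E : (unpickle k) => [c|]; last by exists (fun=> set0).
  have [[S [SK cS]]|nS] := pselect (exists S, inK mm G S /\ code c S).
    exists S => _ [<-] T TK cT; apply/funext => i; apply/seteqP.
    by split; exact: code_uniq.
  by exists (fun=> set0) => _ [<-] T TK cT; case: nS; exists T.
exists e => S SK; have [c cS] := code_ex S SK.
by exists (pickle c); apply: eP cS; rewrite ?pickleK.
Qed.

End PartialMaps.

Arguments tuple_le_refl {M n} S i p _ : rename.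
Arguments tuple_le_trans {M n T S U} ST TU i p _ : rename.
Arguments pullback_le {M n a S T} ST i p _ : rename.

(** * Tuples in [G^n] meeting countably many density requirements *)

Section Generic.
Variables (R : realType) (L : language) (M : countType) (mm : structure L M).
Variables (G : set (selfmaps M)) (n : nat).
Hypothesis hG : perm_group G.
Hypothesis hGop : preserves_operations mm G.
Hypothesis hcm : completely_metrizable R G.
Implicit Types (S T U V W : ptuple n M) (h : 'I_n -> G) (B C : seq M).

Lemma in_sigmaK_graphs h : in_sigmaK mm G (graphs h).
Proof.
pose s k := restriction mm h (pmap unpickle (iota 0 k)).
have sub k l : (k <= l)%N ->
    {subset pmap (@unpickle M) (iota 0 k) <= pmap unpickle (iota 0 l)}.
  move=> kl x; rewrite !mem_pmap => /mapP[j + xE].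
  rewrite mem_iota => /andP[_ jk]; apply/mapP; exists j => //.
  by rewrite mem_iota /=; lia.
exists s; first split=> k.
- exact: restriction_inK.
- move=> i [x y] [/= gx ->]; split=> //=; apply: generated_le gx.
  exact: (sub k k.+1 (leqnSn k)).
- apply/funext => i; apply/seteqP; split=> [[x y] xy|p [k _ []//]].
  exists (pickle x).+1 => //; split; last exact: xy.
  have xs : x \in pmap unpickle (iota 0 (pickle x).+1).
    rewrite mem_pmap; apply/mapP; exists (pickle x); last by rewrite pickleK.
    by rewrite mem_iota; lia.
  exact: subset_generated xs.
Qed.

Lemma chain_monotone (s : nat -> ptuple n M) k l :
  (forall k, tuple_le (s k) (s k.+1)) -> (k <= l)%N -> tuple_le (s k) (s l).
Proof.
move=> sS; elim: l => [|l IH].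
  by rewrite leqn0 => /eqP->; exact: tuple_le_refl.
rewrite leq_eqVlt => /orP[/eqP->|/IH sl]; first exact: tuple_le_refl.
exact: (tuple_le_trans sl (sS l)).
Qed.

(** In each coordinate the union is a permutation which agrees on every finite set with an element
    of [G] extending a late stage, so closedness of [G] applies. *)
Lemma total_chain_union (s : nat -> ptuple n M) :
  chain mm G s ->
  (forall i x, exists k y, s k i (x, y)) ->
  (forall i y, exists k x, s k i (x, y)) ->
  exists h, chain_union s = graphs h.
Proof.
move=> [sK sS] dom rng.
have ext k i : exists2 a, G a & s k i `<=` graph a by case: (sK k i).
have mono k l i : (k <= l)%N -> s k i `<=` s l i.
  by move=> kl; exact: chain_monotone.
have /choice[h hE] : forall i, exists a : G,
    \bigcup_k s k i = graph (val a : M -> M).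
  move=> i.
  have /choice[p pP] : forall x, exists y, exists k, s k i (x, y).
    by move=> x; have [k [y]] := dom i x; exists y, k.
  have /choice[q qP] : forall y, exists x, exists k, s k i (x, y).
    by move=> y; have [k [x]] := rng i y; exists x, k.
  have common k l x y x' y' : s k i (x, y) -> s l i (x', y') ->
      exists a, [/\ G a, y = a x & y' = a x'].
    move=> sk sl; have [a Ga aP] := ext (maxn k l) i; exists a; split=> //.
      exact: (aP _ (mono _ _ _ (leq_maxl k l) _ sk)).
    exact: (aP _ (mono _ _ _ (leq_maxr k l) _ sl)).
  have pq : cancel p q.
    move=> x; have [k sk] := pP x; have [l sl] := qP (p x).
    have [a [Ga ax ay]] := common _ _ _ _ _ _ sk sl.
    by apply: (subgroup_inj hG Ga); rewrite -ay -ax.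
  have qp : cancel q p.
    move=> y; have [k sk] := qP y; have [l sl] := pP (q y).
    by have [a [_ ya ->]] := common _ _ _ _ _ _ sk sl; rewrite -ya.
  have Gp : G p.
    apply: (complete_perm_group_closed hG hcm pq qp) => B.
    have [k kB] : exists k, forall x, x \in B -> s k i (x, p x).
      elim: B => [|x B [k kB]]; first by exists 0%N.
      have [l sl] := pP x; exists (maxn k l) => y.
      rewrite inE => /orP[/eqP->|yB].
        exact: (mono _ _ _ (leq_maxr k l)).
      by apply: (mono _ _ _ (leq_maxl k l)); exact: kB.
    have [a Ga aP] := ext k i; exists a => // x /kB /aP.
    by rewrite /graph /= => ->.
  exists (bundle Gp); apply/seteqP; split=> [[x y] [k _ sk]|[x y]].
    rewrite /graph /=; have [l sl] := pP x.
    by have [a [_ ya ->]] := common _ _ _ _ _ _ sk sl; rewrite -ya.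
  by rewrite /graph /= => ->; have [l sl] := pP x; exists l.
by exists h; apply/funext.
Qed.

(** A Baire category argument on chains: step [k] puts the [k]-th element of [M] into all domains
    and ranges and meets the [k]-th requirement. *)
Lemma generic_tuple (I : countType) S (D : I -> ptuple n M -> Prop) :
  inK mm G S ->
  (forall j T, inK mm G T -> tuple_le S T ->
     exists U, [/\ inK mm G U, tuple_le T U & D j U]) ->
  exists h, tuple_le S (graphs h) /\
    forall j, exists U, [/\ inK mm G U, tuple_le U (graphs h) & D j U].
Proof.
move=> SK dense.
pose P k T U := [/\ tuple_le T U,
  forall m : M, unpickle k = Some m -> forall i,
    (exists y, U i (m, y)) /\ (exists x, U i (x, m)) &
  forall j : I, unpickle k = Some j -> D j U].
have step k T : inK mm G T /\ tuple_le S T ->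
    exists2 U, inK mm G U /\ tuple_le S U & P k T U.
  move=> [TK ST].
  have [T1 [T1K TT1 T1tot]] : exists T1, [/\ inK mm G T1, tuple_le T T1 &
      forall m : M, unpickle k = Some m -> forall i,
        (exists y, T1 i (m, y)) /\ (exists x, T1 i (x, m))].
    case E : (unpickle k) => [m|]; last first.
      by exists T; split=> //; exact: tuple_le_refl.
    have [h Th] := inK_extension TK.
    have [B BT] := inK_generators TK.
    have /choice[q qP] : forall i, exists x, val (h i) x = m.
      move=> i; have [b [_ _ hb]] := subgroup_inv hG (subgroup_val (h i)).
      by exists (b m).
    (* [m] itself serves the domains; its preimage [q i] puts it into the range of coordinate
       [i]. *)
    pose C := m :: [seq q i | i <- enum 'I_n] ++ B.
    exists (restriction mm h C); split; first exact: restriction_inK.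
      apply: le_restriction => // x /BT; apply: generated_le => y yB.
      by rewrite /C inE mem_cat yB !orbT.
    move=> _ [<-] i; split.
      exists (val (h i) m); split=> //; apply: subset_generated.
      by rewrite /= /C inE eqxx.
    exists (q i); split; last by rewrite /= qP.
    apply: subset_generated; rewrite /= /C inE mem_cat map_f ?orbT //.
    by rewrite mem_enum.
  have ST1 := tuple_le_trans ST TT1.
  have [U [UK TU UD]] : exists U, [/\ inK mm G U, tuple_le T1 U &
      forall j : I, unpickle k = Some j -> D j U].
    case E : (unpickle k) => [j|]; last first.
      by exists T1; split=> //; exact: tuple_le_refl.
    have [U [UK TU DU]] := dense j T1 T1K ST1.
    by exists U; split=> // _ [<-].
  exists U; first by split=> //; exact: tuple_le_trans ST1 TU.
  split=> //; first exact: tuple_le_trans TT1 TU.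
  move=> m mk i; have [[y ?] [x ?]] := T1tot m mk i.
  by split; [exists y|exists x]; exact: TU.
have [u [u0 uP]] := indexed_choice (conj SK (tuple_le_refl S)) step.
have uK k : inK mm G (u k) by have [[]] := uP k.
have uchain : chain mm G u by split=> // k; have [_ []] := uP k.
have [i x|i y|h hE] := total_chain_union uchain.
- have [_ [_ /(_ x (pickleK x) i)[[y xy] _] _]] := uP (pickle x).
  by exists (pickle x).+1, y.
- have [_ [_ /(_ y (pickleK y) i)[_ [x xy]] _]] := uP (pickle y).
  by exists (pickle y).+1, x.
- have uh k : tuple_le (u k) (graphs h) by rewrite -hE => i p up; exists k.
  exists h; split; first by rewrite -u0.
  move=> j; have [_ [_ _ /(_ j (pickleK j))]] := uP (pickle j).
  by exists (u (pickle j).+1).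
Qed.

End Generic.

(** * From JEP and WAP to a weakly injective tuple *)

Section Amalgamation.
Variables (R : realType) (L : language) (M : countType) (mm : structure L M).
Variables (G : set (selfmaps M)) (n : nat).
Hypothesis hG : perm_group G.
Hypothesis hGop : preserves_operations mm G.
Hypothesis hcm : completely_metrizable R G.
Implicit Types (S T U V W : ptuple n M) (h : 'I_n -> G).

Lemma zdefs_le S T : tuple_le S T -> zdefs S `<=` zdefs T.
Proof.
by move=> ST x [i _ [[y]|[y]] xy]; exists i => //; [left|right]; exists y;
  exact: ST xy.
Qed.

Lemma JEP_extension S T : JEP mm G n -> inK mm G S -> inK mm G T ->
  exists U a, [/\ inK mm G U, tuple_le S U, G a & tuple_le T (pullback a U)].
Proof.
move=> jep SK TK; have [U UK [[phi phiE] [psi psiE]]] := jep S T SK TK.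
have [a [Ga _ SU _]] := embedding_extension phiE.
have [b [Gb _ TU _]] := embedding_extension psiE.
have [c [Gc ac ca]] := subgroup_inv hG Ga.
exists (pullback a U), (c \o b); split=> //; first exact: pullback_inK.
  exact: subgroup_comp.
rewrite (_ : pullback _ _ = pullback b U) //.
by apply/funext => i; apply/funext => p; rewrite /pullback /= !ca.
Qed.

(* Pulling the amalgam back along one of the two amalgamating embeddings turns
   that embedding into an inclusion. *)
Definition amalgamation_witness S T : Prop :=
  forall U V, inK mm G U -> inK mm G V -> tuple_le T U -> tuple_le T V ->
  exists W a, [/\ inK mm G W, tuple_le V W, G a, tuple_le U (pullback a W) &
    forall x, zdefs S x -> a x = x].

Lemma amalgamation_witness_le S S' T T' : tuple_le S' S -> tuple_le T T' ->
  amalgamation_witness S T -> amalgamation_witness S' T'.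
Proof.
move=> SS TT wit U V UK VK T'U T'V.
have [W [a [WK VW Ga UW aid]]] :=
  wit U V UK VK (tuple_le_trans TT T'U) (tuple_le_trans TT T'V).
by exists W, a; split=> // x /(zdefs_le SS) /aid.
Qed.

(** The witness is the target of [tau] pulled back along an extension [t] of [tau]. Every tuple
    above it receives the original target through the inverse of [t], so that WAP applies. *)
Lemma WAP_witness S : WAP mm G n -> inK mm G S ->
  exists T, [/\ inK mm G T, tuple_le S T & amalgamation_witness S T].
Proof.
move=> wap SK; have [T [tau [TK tauE amalg]]] := wap S SK.
have [t [Gt taut ST tauS]] := embedding_extension tauE.
have [t' [Gt' tt' t't]] := subgroup_inv hG Gt.
exists (pullback t T); split=> //; first exact: pullback_inK.
move=> U V UK VK TU TV.
have emb X : tuple_le (pullback t T) X -> embedding mm G (graph t') T X.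
  by move=> TX; apply: embedding_graph => //;
    rewrite -(pullbackK T t't); exact: pullback_le.
have [W [phi' [psi' [WK phiE psiE com]]]] :=
  amalg U V _ _ UK VK (emb U TU) (emb V TV).
have [b [Gb _ UW phib]] := embedding_extension phiE.
have [c [Gc psic VW _]] := embedding_extension psiE.
have [c' [Gc' cc' c'c]] := subgroup_inv hG Gc.
exists (pullback c W), (c' \o b); split=> //; first exact: pullback_inK.
- exact: subgroup_comp.
- rewrite (_ : pullback _ _ = pullback b W) //.
  by apply/funext => i; apply/funext => p; rewrite /pullback /= !c'c.
(* On [S] the commuting square reads [b x = c x], because [t'] undoes [tau]. *)
- move=> x Sx; have [+ _] := com x Sx (b x).
  have Ux := zdefs_le (tuple_le_trans ST TU) Sx.
  case=> [|z /= [w xw wz] zb].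
    exists x; last exact: phib.
    by exists (t x); [exact: tauS|rewrite /graph /= tt'].
  have wE : w = t x := taut _ xw.
  have zE : z = t' w := wz.
  have -> : b x = c z := psic _ zb.
  by rewrite zE wE tt' /= cc'.
Qed.

Definition compatible S T : Prop :=
  exists U, [/\ inK mm G U, tuple_le S U & tuple_le T U].

Lemma weakly_injective_of_amalgamation : JEP mm G n -> WAP mm G n ->
  exists Phi : 'I_n -> G, weakly_injective mm G (graphs Phi).
Proof.
move=> jep wap.
have [e eP] := @inK_countable _ _ mm G n hGop.
(* Three kinds of requirements: [e k] embeds; an amalgamation witness for [e k] appears; an
   extension [e m] of a witness [e l] for [e k] embeds over [e k]. The compatibility premises make
   the last two vacuous for tuples that cannot lie below the generic one. *)
pose D (j : nat + nat + nat * nat * nat) U := match j with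
  | inl (inl k) => inK mm G (e k) ->
      exists2 a, G a & tuple_le (e k) (pullback a U)
  | inl (inr k) => inK mm G (e k) -> compatible (e k) U ->
      tuple_le (e k) U /\ amalgamation_witness (e k) U
  | inr (k, l, m) => inK mm G (e m) -> amalgamation_witness (e k) (e l) ->
      tuple_le (e l) (e m) -> compatible (e l) U ->
      exists a, [/\ G a, tuple_le (e m) (pullback a U) &
        forall x, zdefs (e k) x -> a x = x]
  end.
pose S0 : ptuple n M := restriction mm (fun=> bundle (subgroup_id hG)) [::].
have S0K : inK mm G S0 by exact: restriction_inK.
have dense j T : inK mm G T -> tuple_le S0 T ->
    exists U, [/\ inK mm G U, tuple_le T U & D j U].
  move=> TK _; case: j => [[k|k]|[[k l] m]] /=.
  - have [ekK|nK] := pselect (inK mm G (e k)); last first.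
      by exists T; split=> //; exact: tuple_le_refl.
    have [U [a [UK TU Ga eU]]] := JEP_extension jep TK ekK.
    by exists U; split=> // _; exists a.
  - have [[V [VK eV TV]]|nc] := pselect (compatible (e k) T); last first.
      by exists T; split=> //; exact: tuple_le_refl.
    have [U [UK VU wit]] := WAP_witness wap VK.
    exists U; split=> //; first exact: tuple_le_trans TV VU.
    move=> _ _; split; first exact: tuple_le_trans eV VU.
    exact: amalgamation_witness_le eV (tuple_le_refl U) wit.
  - have [[V [VK eV TV]]|nc] := pselect (compatible (e l) T); last first.
      by exists T; split=> //; exact: tuple_le_refl.
    have [[emK wit lm]|nh] := pselect [/\ inK mm G (e m),
        amalgamation_witness (e k) (e l) & tuple_le (e l) (e m)]; last first.
      by exists T; split=> // [|? ? ?]; [exact: tuple_le_refl|case: nh].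
    (* [e m] and [V] both extend the witness [e l]; their amalgam contains [V], hence [T]. *)
    have [W [a [WK VW Ga eW aid]]] := wit (e m) V emK VK lm eV.
    by exists W; split=> //; [exact: tuple_le_trans TV VW|exists a].
have [Phi [_ PhiD]] := generic_tuple hG hGop hcm S0K dense.
have compat S U : inK mm G S -> inK mm G U -> tuple_le S (graphs Phi) ->
    tuple_le U (graphs Phi) -> compatible S U.
  move=> SK UK SP UP.
  have [V [VK SV UV _]] := inK_compatible hG hGop SK UK SP UP.
  by exists V.
exists Phi; split; first split; first exact: in_sigmaK_graphs.
  move=> S SK; have [k ek] := eP S SK.
  have [U [UK UPhi /=]] := PhiD (inl (inl k)); rewrite ek => /(_ SK)[a Ga SU].
  by exists (graph a); apply: embedding_graph => // i p /SU /UPhi.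
move=> S SK SPhi; have [k ek] := eP S SK.
have [T [TK TPhi /=]] := PhiD (inl (inr k)).
rewrite ek => /(_ SK (compat _ _ SK TK SPhi TPhi))[ST wit].
exists T; split=> // U UK TU; have [l el] := eP T TK; have [m em] := eP U UK.
have [V [VK VPhi /=]] := PhiD (inr (k, l, m)); rewrite ek el em.
move=> /(_ UK wit TU (compat _ _ TK VK TPhi VPhi))[a [Ga UV aid]].
exists (graph a); first by apply: embedding_graph => // i p /UV /VPhi.
by move=> i x [y xy]; rewrite /graph /= aid //; exists i => //; left; exists y.
Qed.

End Amalgamation.

(** * From a weakly injective tuple to a winning strategy of Odd *)

Section Strategy.
Variables (R : realType) (L : language) (M : countType) (mm : structure L M).
Variables (G : set (selfmaps M)) (n : nat).
Hypothesis hG : perm_group G.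
Hypothesis hGop : preserves_operations mm G.
Hypothesis hcm : completely_metrizable R G.
Hypothesis hn : (0 < n)%N.
Variable Phi : 'I_n -> G.
Hypothesis Phi_injective : weakly_injective mm G (graphs Phi).
Implicit Types (P S T U V : ptuple n M) (a b : M -> M).

Definition agree_on P a b : Prop := forall i x, (P i).`1 x -> a x = b x.

(* Odd remembers an embedding [a] of the current position [T] into [Phi] and a
   smaller [P], such that every later position still embeds into [Phi] by some
   map which agrees with [a] on [P]. *)
Definition extendible_over a P T : Prop :=
  [/\ G a, inK mm G T, tuple_le T (pullback a (graphs Phi)) &
    forall U, inK mm G U -> tuple_le T U ->
      exists b, [/\ G b, tuple_le U (pullback b (graphs Phi)) & agree_on P b a]].

(** The position is moved into [Phi] by [a], enlarged there by weak injectivity, and moved back. The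
    optional point [m] is the back-and-forth task of the round. *)
Lemma odd_step a U (m : option M) :
  G a -> inK mm G U -> tuple_le U (pullback a (graphs Phi)) ->
  exists P T, [/\ tuple_le U P, tuple_le P T, extendible_over a P T &
    forall y, m = Some y -> forall i,
      (P i).`1 y /\ exists2 x, (P i).`1 x & a x = y].
Proof.
move=> Ga UK UPhi; have [a' [Ga' aa' a'a]] := subgroup_inv hG Ga.
have U'Phi : tuple_le (pullback a' U) (graphs Phi).
  by rewrite -[graphs Phi](pullbackK _ a'a); exact: pullback_le.
have U'K : inK mm G (pullback a' U) by exact: pullback_inK.
have [B UB] := inK_generators U'K.
(* Having [a y] in [C] puts [y] into the domain of [pullback a P']; having [y] in [C] puts its
   preimage [a' y] there. *)
pose C := B ++ seq_of_opt (omap a m) ++ seq_of_opt m.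
have memC y : m = Some y -> a y \in C /\ y \in C.
  by rewrite /C => ->; rewrite !mem_cat; split; apply/or3P;
    [apply: Or32|apply: Or33]; rewrite mem_head.
pose P' := restriction mm Phi C.
have P'K : inK mm G P' by exact: restriction_inK.
have [_ /(_ P' P'K (@restriction_le _ _ mm G n Phi C))] := Phi_injective.
move=> [T' [T'K PT' T'Phi T'inj]].
have P'dom i x : x \in C -> (P' i).`1 x.
  by move=> xC; exists (val (Phi i) x); split=> //; exact: subset_generated.
exists (pullback a P'), (pullback a T'); split.
- rewrite -[U](pullbackK _ aa'); apply: pullback_le.
  apply: le_restriction => // x /UB; apply: generated_le => y yB.
  by rewrite mem_cat yB.
- exact: pullback_le.
- split=> //; [exact: pullback_inK|exact: pullback_le|].
  move=> V VK TV.
  have V'K : inK mm G (pullback a' V) by exact: pullback_inK.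
  have T'V' : tuple_le T' (pullback a' V).
    by rewrite -[T'](pullbackK _ a'a); exact: pullback_le.
  have [phi phiE phi1] := T'inj _ V'K T'V'.
  have [f [Gf phif V'f _]] := embedding_extension phiE.
  exists (f \o a); split; first exact: subgroup_comp.
    by rewrite -[V](pullbackK _ aa'); exact: (pullback_le V'f).
  move=> i x [y xy] /=.
  have /phi1/phif /= fa : (P' i).`1 (a x) by exists (a y).
  by symmetry; exact: fa.
- move=> y /memC[ayC yC] i; split.
    by have [z Pz] := P'dom i _ ayC; exists (a' z); rewrite /pullback /= a'a.
  exists (a' y); last by rewrite a'a.
  by have [z Pz] := P'dom i _ yC; exists (a' z); rewrite /pullback /= !a'a.
Qed.

Lemma odd_wins_of_weakly_injective : odd_wins_BM mm G (graphs Phi).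
Proof.
pose state := ((M -> M) * ptuple n M * ptuple n M)%type.
pose legal U T := inK mm G T /\ tuple_le U T.
pose good k (st : state) U (st' : state) :=
  [/\ agree_on st.1.2 st'.1.1 st.1.1, tuple_le U st'.1.2,
    tuple_le st'.1.2 st'.2, extendible_over st'.1.1 st'.1.2 st'.2 &
    forall y, unpickle k = Some y -> forall i,
      (st'.1.2 i).`1 y /\ exists2 x, (st'.1.2 i).`1 x & st'.1.1 x = y].
pose embeds_over (st : state) U :=
  exists b, [/\ G b, tuple_le U (pullback b (graphs Phi)) &
    agree_on st.1.2 b st.1.1].
have /choice[F FP] : forall x : nat * state * ptuple n M, exists st' : state,
    inK mm G x.2 -> legal x.2 st'.2 /\
    (embeds_over x.1.2 x.2 -> good x.1.1 x.1.2 x.2 st').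
  move=> [[k st] U] /=.
  have [UK|nK] := pselect (inK mm G U); last by exists st.
  have [[b [Gb Ub ba]]|nb] := pselect (embeds_over st U); last first.
    (* Without a suitable embedding Odd repeats Eve's move, which keeps the strategy legal in every
       play. *)
    by exists (id, U, U) => _; split=> //; split=> //; exact: tuple_le_refl.
  have [P [T [UP PT ext tot]]] := odd_step (unpickle k) Gb UK Ub.
  exists (b, P, T) => _; split; last by [].
  by split; [case: ext|exact: tuple_le_trans UP PT].
(* With an empty [P] there is nothing to agree on, so universality alone gives the first
   embedding. *)
pose empty : state := (id, fun=> set0, fun=> set0).
pose st := fix st (s : nat -> ptuple n M) k := match k with
  | 0 => F (0, empty, s 0)%N
  | k'.+1 => F (k, st s k', s k.*2)
  end.
have st_ext s s' k : (forall j, (j <= k)%N -> s j.*2 = s' j.*2) ->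
    st s k = st s' k.
  elim: k => [|k IH] ss' /=; first by rewrite (ss' 0%N).
  by rewrite IH ?(ss' k.+1) // => j jk; apply: ss'; exact: leqW.
(* Odd moves at positions of length [2k+1], whose half is the round [k]; the memory is recomputed
   from Eve's moves alone. *)
pose sigma (l : seq (ptuple n M)) := (st (nth (fun=> set0) l) (size l)./2).2.
have sigmaE s k : sigma (mkseq s k.*2.+1) = (st s k).2.
  rewrite /sigma size_mkseq /= uphalf_double; congr (_.2).
  by apply: st_ext => j jk; rewrite nth_mkseq //; lia.
exists sigma; split=> [s k sK sS|s [sK sS] sodd].
  rewrite sigmaE.
  case: k sK {sS} => [|k] sK.
    by have [] := FP (0%N, empty, s 0%N) (sK _ (leqnn _)).
  by have [] := FP (k.+1, st s k, s k.+1.*2) (sK _ (leqnn _)).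
pose a k := (st s k).1.1; pose P k := (st s k).1.2; pose T k := (st s k).2.
have sT k : s k.*2.+1 = T k by rewrite sodd sigmaE.
have goodP k : good k (if k is k'.+1 then st s k' else empty) (s k.*2) (st s k).
  elim: k => [|k [_ _ _ ext _]].
    have /= [_ H] := FP (0%N, empty, s 0%N) (sK 0%N); apply: H.
    have [phi phiE] := Phi_injective.1.2 _ (sK 0%N).
    have [b [Gb _ Sb _]] := embedding_extension phiE.
    by exists b; split=> // i x [y []].
  have /= [_ H] := FP (k.+1, st s k, s k.+1.*2) (sK _); apply: H.
  have [_ _ _] := ext; apply; first exact: sK.
  by rewrite -/(T k) -sT; exact: sS.
have sP k : tuple_le (s k.*2) (P k) by have [] := goodP k.
have PT k : tuple_le (P k) (T k) by have [] := goodP k.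
have ext k : extendible_over (a k) (P k) (T k) by have [] := goodP k.
have Ga k : G (a k) by have [] := ext k.
have aS k : agree_on (P k) (a k.+1) (a k) by have [] := goodP k.+1.
have Pmono k l : (k <= l)%N -> tuple_le (P k) (P l).
  apply: chain_monotone => {k l} k; apply: tuple_le_trans (PT k) _.
  by rewrite -sT; apply: tuple_le_trans (sS _) (sP k.+1).
have amono k l : (k <= l)%N -> agree_on (P k) (a l) (a k).
  elim: l => [|l IH]; first by rewrite leqn0 => /eqP->.
  rewrite leq_eqVlt => /orP[/eqP->//|kl] i x xP.
  rewrite -(IH kl i x xP); apply: (aS l i).
  by have [y xy] := xP; exists y; exact: (Pmono k l kl).
have Pdom k i y : unpickle k = Some y -> (P k i).`1 y.
  by move=> ky; have [_ _ _ _ /(_ y ky i)[]] := goodP k.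
(* Domains are tested in one coordinate, which exists because [0 < n]. *)
pose i0 := Ordinal hn.
(* From round [pickle x] on, [x] lies in the domain of every [P], so the maps [a] no longer change
   at [x]. *)
pose p x := a (pickle x) x.
have pE x l : (pickle x <= l)%N -> p x = a l x.
  by move=> xl; rewrite (amono _ _ xl i0) //; apply: Pdom; rewrite pickleK.
have /choice[q qP] : forall y, exists x, p x = y.
  move=> y; have [_ _ _ _ /(_ y (pickleK y) i0)[_ [x xP xy]]] := goodP (pickle y).
  exists x; rewrite (pE x _ (leq_maxl _ (pickle y))).
  by rewrite (amono _ _ (leq_maxr (pickle x) (pickle y)) i0).
have Gp : G p.
  apply: (complete_perm_group_closed hG hcm (q := q)) => [x||B].
  - have /subgroup_inj := Ga (maxn (pickle x) (pickle (q (p x)))); apply=> //.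
    by rewrite -!pE ?leq_maxl ?leq_maxr // qP.
  - exact: qP.
  - exists (a (\max_(x <- B) pickle x)) => // x xB; rewrite -pE //.
    by rewrite (big_rem x xB) leq_maxl.
have Sp : tuple_le (chain_union s) (pullback p (graphs Phi)).
  move=> i [x y] [k _ sxy]; pose l := maxn k (maxn (pickle x) (pickle y)).
  rewrite /pullback /= !(pE _ l); [|by rewrite /l; lia..].
  have [_ _ TPhi _] := ext l; apply: (TPhi i (x, y)); rewrite -sT.
  by apply: (chain_monotone sS _ sxy); rewrite /l; lia.
exists (graph p); split; first exact: embedding_graph.
move=> i; apply/seteqP; split.
  by have [_ _ _] := embedding_graph mm Gp Sp; apply.
(* The reverse inclusion holds because the union of the play is already defined at [x]. *)
move=> [x z] /= [w wx zw].
have {}wx : w = p x := wx; have {}zw : z = val (Phi i) w := zw.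
have [y xy] : (P (pickle x) i).`1 x by apply: Pdom; rewrite pickleK.
have Sxy : chain_union s i (x, y).
  by exists (pickle x).*2.+1 => //; rewrite sT; exact: PT.
exists y => //; have <- : p y = z by rewrite zw wx; exact: (Sp i _ Sxy).
by [].
Qed.

End Strategy.

(** * Boxes of the tuples extending a member of [K] *)

Section BoxTopology.
Variables (L : language) (M : countType) (mm : structure L M).
Variables (G : set (selfmaps M)) (n : nat).
Hypothesis hG : perm_group G.
Hypothesis hGop : preserves_operations mm G.
Implicit Types (S T U V : ptuple n M) (h x y : {ptws 'I_n -> G}) (B C : seq M).

(** Membership in the box of [V] depends only on the values at the finitely many points of [B]. *)
Lemma box_clopen V B x : zdefs V `<=` generated mm B ->
  nbhs x [set y : {ptws 'I_n -> G} |
    tuple_le V (graphs y) <-> tuple_le V (graphs x)].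
Proof.
move=> VB.
have half (y z : 'I_n -> G) : (forall i, {in B, val (y i) =1 val (z i)}) ->
    tuple_le V (graphs y) -> tuple_le V (graphs z).
  move=> yz Vy i [u v] uv; have vE : v = val (y i) u := Vy i _ uv.
  have -> : v = val (z i) u; last by [].
  rewrite vE.
  apply: (eq_generated hGop (subgroup_val (y i)) (subgroup_val (z i)) (yz i)).
  by apply: VB; exists i => //; left; exists v.
apply: (@filterS _ _ (nbhs_filter x)) (tuple_evaluation_nbhs x B) => y yx.
split; apply: half => //.
by move=> i m mB; rewrite yx.
Qed.

Lemma box_basis T B C h (O : set {ptws 'I_n -> G}) :
  nbhs h O -> zdefs T `<=` generated mm B -> tuple_le T (graphs h) ->
  exists V, [/\ inK mm G V, tuple_le T V, tuple_le V (graphs h),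
    forall m i, m \in C -> (V i).`1 m &
    forall x, tuple_le V (graphs x) -> O x].
Proof.
move=> /tuple_nbhs[A AO] TB Th; exists (restriction mm h (A ++ B ++ C)).
have sub i m : m \in A ++ B ++ C ->
    restriction mm h (A ++ B ++ C) i (m, val (h i) m).
  by move=> mABC; split=> //; exact: subset_generated.
split.
- exact: restriction_inK.
- apply: le_restriction => // x /TB; apply: generated_le => y yB.
  by rewrite !mem_cat yB orbT.
- exact: restriction_le.
- by move=> m i mC; exists (val (h i) m); apply: sub; rewrite !mem_cat mC !orbT.
- move=> x Vx; apply: AO => i m mA; symmetry; apply: (Vx i (m, _)).
  by apply: sub; rewrite mem_cat mA.
Qed.

End BoxTopology.

(** * From a winning strategy to a comeager diagonal class *)

Section ComeagerClass.
Variables (L : language) (M : countType) (mm : structure L M).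
Variables (G : set (selfmaps M)) (n : nat).
Hypothesis hG : perm_group G.
Hypothesis hGop : preserves_operations mm G.
Implicit Types (S T U V E : ptuple n M) (x : {ptws 'I_n -> G}).
Implicit Types (r : seq (ptuple n M)) (l : seq nat).

(** As the last entry of the empty play it puts no constraint on Eve's first move. *)
Let nothing : ptuple n M := fun=> set0.

Definition legal r : Prop :=
  (forall j, (j < size r)%N -> inK mm G (nth nothing r j)) /\
  (forall j, (j.+1 < size r)%N ->
     tuple_le (nth nothing r j) (nth nothing r j.+1)).

Lemma legal_rcons r E : legal r -> inK mm G E -> tuple_le (last nothing r) E ->
  legal (rcons r E).
Proof.
move=> [rK rS] EK rE; split=> j; rewrite size_rcons ltnS.
  by rewrite leq_eqVlt nth_rcons => /orP[/eqP->|jr];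
    rewrite ?ltnn ?eqxx // jr; exact: rK.
rewrite leq_eqVlt !nth_rcons => /orP[/eqP jr|jr].
  by rewrite -jr ltnn eqxx ltnSn; move: rE; rewrite -nth_last -jr.
by rewrite jr (ltnW jr); exact: rS.
Qed.

Lemma legal_last_generators r : legal r ->
  exists B, zdefs (last nothing r) `<=` generated mm B.
Proof.
case: (lastP r) => [_|r' E [rK _]].
  by exists [::] => y [i _ [] [z]].
apply: inK_generators; rewrite last_rcons.
have := rK (size r'); rewrite size_rcons nth_rcons ltnn eqxx; exact.
Qed.

Definition add_round (sigma : seq (ptuple n M) -> ptuple n M) r E :=
  rcons (rcons r E) (sigma (rcons r E)).

Lemma legal_add_round sigma Phi r k E : odd_winning_strategy mm G Phi sigma ->
  legal r -> size r = k.*2 -> inK mm G E -> tuple_le (last nothing r) E ->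
  [/\ legal (add_round sigma r E),
    inK mm G (last nothing (add_round sigma r E)) &
    tuple_le E (last nothing (add_round sigma r E))].
Proof.
move=> [sleg _] rleg rk EK rE; have rEleg := legal_rcons rleg EK rE.
have rEsz : size (rcons r E) = k.*2.+1 by rewrite size_rcons rk.
have [] := sleg (nth nothing (rcons r E)) k.
- by move=> j jk; apply: rEleg.1; rewrite rEsz.
- by move=> j jk; apply: rEleg.2; rewrite rEsz.
rewrite -!rEsz mkseq_nth nth_rcons rk ltnn eqxx => sK sE.
rewrite /add_round last_rcons; split=> //; apply: legal_rcons => //.
by rewrite last_rcons.
Qed.

Lemma comeager_of_odd_wins (Phi : 'I_n -> G) : (0 < n)%N ->
  odd_wins_BM mm G (graphs Phi) -> comeager (diagonal_class Phi).
Proof.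
move=> hn [sigma win]; have [e eP] := @inK_countable _ _ mm G n hGop.
(* A list of indices encodes Eve's moves, and Odd replies by [sigma]; thus only countably many
   finite plays are considered. *)
pose hist l := foldl (fun r k => add_round sigma r (e k)) [::] l.
pose top l := last nothing (hist l).
have histE l k : hist (rcons l k) = add_round sigma (hist l) (e k).
  by rewrite /hist foldl_rcons.
have sizeE l : size (hist l) = (size l).*2.
  elim/last_ind: l => // l k IH.
  by rewrite histE /add_round !size_rcons IH doubleS.
(* The third clause makes Eve define her maps at one more point in each round, so that the final
   union is total. *)
pose next x l k := [/\ inK mm G (e k), tuple_le (top l) (e k),
  forall m i, unpickle (size l) = Some m -> (e k i).`1 m &
  tuple_le (top (rcons l k)) (graphs x)].
pose D l : set {ptws 'I_n -> G} :=
  [set x | legal (hist l) -> tuple_le (top l) (graphs x) ->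
    exists k, next x l k].
have add_round_top l k x : legal (hist l) -> inK mm G (e k) ->
    tuple_le (top l) (e k) ->
    [/\ legal (hist (rcons l k)), inK mm G (top (rcons l k)) &
      tuple_le (e k) (top (rcons l k))].
  move=> lleg eK le; rewrite /top histE.
  exact: (legal_add_round win lleg (sizeE l) eK le).
(* If [x] is outside the box of [top l], so are its neighbours; otherwise the box of the reply that
   [x] extends is a neighbourhood of [x] inside [D l]. *)
have Dopen l : open (D l).
  rewrite openE => x; rewrite /interior.
  have [lleg|nl] := pselect (legal (hist l)); last first.
    by move=> _; apply: filterS (@filterT _ (nbhs x) _) => y _ /nl.
  have [B lB] := legal_last_generators lleg.
  have [lx|nx] := pselect (tuple_le (top l) (graphs x)); last first.
    by move=> _; apply: filterS (box_clopen hGop x lB) => y [yx _] _ /yx /nx.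
  move=> /(_ lleg lx)[k [eK le em topx]].
  have [_ /inK_generators[C kC] _] := add_round_top l k x lleg eK le.
  apply: filterS (box_clopen hGop x kC) => y [_ /(_ topx) topy] _ _.
  by exists k.
have Ddense l : dense (D l).
  move=> O [x Ox] oO; have [Dx|nDx] := pselect (D l x); first by exists x.
  have /not_implyP[lleg /not_implyP[lx _]] := nDx.
  have [B lB] := legal_last_generators lleg.
  have nO : nbhs x O by exact: open_nbhs_nbhs.
  (* Eve plays a tuple whose box lies in [O]; whatever extends Odd's reply is in [O] and in
     [D l]. *)
  have [E [EK lE Ex Em EO]] :=
    box_basis hG hGop (seq_of_opt (unpickle (size l))) nO lB lx.
  have [k ek] := eP E EK.
  have [||_ topK etop] := add_round_top l k x lleg; rewrite ?ek //.
  have [y topy] := inK_extension topK.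
  exists y; split.
    by apply: EO; rewrite -ek; exact: tuple_le_trans etop topy.
  move=> _ _; exists k; split; rewrite ?ek // => m i lm; apply: Em.
  by rewrite lm mem_head.
exists (fun k => if unpickle k is Some l then D l else setT) => [k|x xD].
  case: unpickle => [l|]; first by split; [exact: Dopen|exact: Ddense].
  by split; [exact: openT|move=> O O0 _; rewrite setIT].
have {}xD l : D l x by have := xD (pickle l) I; rewrite pickleK.
have /choice[F FP] : forall l, exists k, legal (hist l) ->
    tuple_le (top l) (graphs x) -> next x l k.
  move=> l; have [lleg|] := pselect (legal (hist l)); last by exists 0%N.
  have [lx|] := pselect (tuple_le (top l) (graphs x)); last by exists 0%N.
  by have [k xk] := xD l lleg lx; exists k.
pose w := fix w j := if j is j'.+1 then rcons (w j') (F (w j')) else [::].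
have wsize j : size (w j) = j by elim: j => //= j; rewrite size_rcons => ->.
have wP j : legal (hist (w j)) /\ tuple_le (top (w j)) (graphs x).
  elim: j => [|j [wleg wx]]; first by split=> // i p [].
  have [eK we _ wx'] := FP _ wleg wx; split=> //.
  by have [] := add_round_top (w j) _ x wleg eK we.
have wnext j : next x (w j) (F (w j)) by have [] := wP j; exact: FP.
pose s j := if odd j then sigma (rcons (hist (w j./2)) (e (F (w j./2))))
  else e (F (w j./2)).
have sE j : hist (w j) = mkseq s j.*2.
  elim: j => // j IH; rewrite /= histE doubleS !mkseqS -IH /add_round.
  by rewrite /s /= odd_double /= uphalf_double doubleK.
have sx k : tuple_le (s k) (graphs x).
  have [_ _ _] := wnext k./2; rewrite /top histE /add_round last_rcons => sx.
  rewrite /s; case: ifP => // _; have [eK we _ _] := wnext k./2.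
  have [_ _] := add_round_top (w k./2) _ x (wP _).1 eK we.
  rewrite /top histE /add_round last_rcons => es.
  exact: tuple_le_trans es sx.
have schain : chain mm G s.
  have nthE k j : (j < k.*2)%N -> nth nothing (hist (w k)) j = s j.
    by move=> jk; rewrite sE nth_mkseq.
  have szE k : size (hist (w k)) = k.*2 by rewrite sizeE wsize.
  split=> k.
    have [wleg _] := (wP k.+1).1; have := wleg k.
    by rewrite szE nthE; [apply|]; lia.
  have [_ wleg] := (wP k.+1).1; have := wleg k.
  by rewrite szE !nthE; [apply| |]; lia.
have sodd k : s k.*2.+1 = sigma (mkseq s k.*2.+1).
  rewrite mkseqS -sE {1}/s /= odd_double /= uphalf_double.
  by rewrite /s odd_double doubleK.
have su : chain_union s = graphs x.
  apply/funext => i; apply/seteqP; split=> [p [k _ /sx//]|[u v] uv].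
  have [_ _ /(_ u i)] := wnext (pickle u).
  rewrite wsize pickleK => /(_ erefl)[v' suv] _.
  have suv' : s (pickle u).*2 i (u, v').
    by rewrite /s odd_double doubleK.
  exists (pickle u).*2 => //.
  have v'E : v' = val (x i) u := sx _ i _ suv'.
  by have -> : v = v' by rewrite v'E.
(* Odd wins this play, so [x] is isomorphic to [Phi], and an extension of the isomorphism in [G]
   conjugates one into the other. *)
have [_ /(_ s schain sodd)[phi []]] := win.
rewrite su => /embedding_extension[a [Ga _ ax _]] _.
have [a' [_ aa' a'a]] := subgroup_inv hG Ga.
exists a, a'; split=> // i; apply/funext => m /=.
apply: (can_inj aa'); rewrite a'a.
exact: (ax i (m, _) erefl).
Qed.

End ComeagerClass.

(** * From a comeager diagonal class to JEP and WAP *)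

Section AmalgamationOfComeager.
Variables (R : realType) (L : language) (M : countType) (mm : structure L M).
Variables (G : set (selfmaps M)) (n : nat).
Hypothesis hG : perm_group G.
Hypothesis hGop : preserves_operations mm G.
Hypothesis hcm : completely_metrizable R G.
Implicit Types (S T U V W : ptuple n M) (h g : 'I_n -> G).

(** The dense open sets witnessing comeagerness join the requirements; they can be met above any [T]
    because its box is open and nonempty. *)
Lemma comeager_generic_tuple (A : set {ptws 'I_n -> G}) (I : countType) S
    (D : I -> ptuple n M -> Prop) :
  comeager A -> inK mm G S ->
  (forall j T, inK mm G T -> tuple_le S T ->
     exists U, [/\ inK mm G U, tuple_le T U & D j U]) ->
  exists h, [/\ A h, tuple_le S (graphs h) &
    forall j, exists U, [/\ inK mm G U, tuple_le U (graphs h) & D j U]].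
Proof.
move=> [Q Qopen QA] SK dense.
pose D' (j : nat + I) U := match j with
  | inl k => forall x : 'I_n -> G, tuple_le U (graphs x) -> Q k x
  | inr j => D j U
  end.
have dense' j T : inK mm G T -> tuple_le S T ->
    exists U, [/\ inK mm G U, tuple_le T U & D' j U].
  move=> TK ST; case: j => [k|j]; last exact: dense.
  have [oQ dQ] := Qopen k; have [y Ty] := inK_extension TK.
  have [B TB] := inK_generators TK.
  have [||x [Tx Qx]] := dQ [set x : {ptws 'I_n -> G} | tuple_le T (graphs x)].
  - by exists y.
  - rewrite openE => x Tx; rewrite /interior.
    by apply: filterS (box_clopen hGop x TB) => z [_]; apply.
  have nQ : nbhs x (Q k) by exact: open_nbhs_nbhs.
  have [V [VK TV _ _ VO]] := box_basis hG hGop [::] nQ TB Tx.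
  by exists V.
have [h [Sh hD]] := generic_tuple hG hGop hcm SK dense'.
exists h; split=> //; last by move=> j; exact: (hD (inr j)).
apply: QA => k _; have [U [_ Uh]] := hD (inl k); exact.
Qed.

Lemma diagonal_class_pullback g h :
  diagonal_class g h -> exists2 a, G a & graphs h = pullback a (graphs g).
Proof.
move=> [a [a' [Ga aa' a'a hE]]]; exists a => //; apply/funext => i.
apply/seteqP; split=> -[x y]; rewrite /graphs /graph /pullback /= hE /=.
  by move=> ->; rewrite a'a.
by move=> <-; rewrite aa'.
Qed.

(** Moved by [a] and [b], both tuples lie below [g], where one restriction of [g] contains them. *)
Lemma joint_restriction g S T a b : G a -> G b -> inK mm G S -> inK mm G T ->
  tuple_le S (pullback a (graphs g)) -> tuple_le T (pullback b (graphs g)) ->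
  exists W, [/\ inK mm G W, tuple_le S (pullback a W) &
    tuple_le T (pullback b W)].
Proof.
move=> Ga Gb SK TK Sg Tg.
have [a' [Ga' aa' a'a]] := subgroup_inv hG Ga.
have [b' [Gb' bb' b'b]] := subgroup_inv hG Gb.
have [W [WK SW TW _]] : exists W, [/\ inK mm G W, tuple_le (pullback a' S) W,
    tuple_le (pullback b' T) W & tuple_le W (graphs g)].
  apply: inK_compatible => //; do ?exact: pullback_inK.
    by rewrite -[graphs g](pullbackK _ a'a); exact: pullback_le.
  by rewrite -[graphs g](pullbackK _ b'b); exact: pullback_le.
exists W; split=> //.
  by rewrite -[S](pullbackK _ aa'); exact: pullback_le.
by rewrite -[T](pullbackK _ bb'); exact: pullback_le.
Qed.

Lemma JEP_of_comeager g : comeager (diagonal_class g) -> JEP mm G n.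
Proof.
move=> com S T SK TK.
have copy X : inK mm G X -> exists2 a, G a & tuple_le X (pullback a (graphs g)).
  move=> XK; have [|h [/diagonal_class_pullback[a Ga hE] Xh _]] :=
    comeager_generic_tuple (D := fun (_ : void) _ => True) com XK.
    by case.
  by exists a; rewrite -?hE.
have [a Ga Sa] := copy S SK; have [b Gb Tb] := copy T TK.
have [W [WK SW TW]] := joint_restriction Ga Gb SK TK Sa Tb.
by exists W => //; split; [exists (graph a)|exists (graph b)];
  exact: embedding_graph.
Qed.

(* By category, one of the countably many sets of conjugates of [g] by elements
   with prescribed values [w] on [B] is dense above some [T]. *)
Lemma locally_dense_conjugates g S B : comeager (diagonal_class g) ->
  inK mm G S -> exists T (w : seq M), [/\ inK mm G T, tuple_le S T &
    forall U, inK mm G U -> tuple_le T U -> exists a,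
      [/\ G a, tuple_le U (pullback a (graphs g)) & map a B = w]].
Proof.
move=> com SK; apply: contrapT => nT.
(* If the claim fails, every [D w] is a dense requirement, and a generic conjugate of [g] by some
   [a] contradicts [D (map a B)]. *)
pose D (w : seq M) U := ~ exists a,
  [/\ G a, tuple_le U (pullback a (graphs g)) & map a B = w].
have [w T TK ST|h [/diagonal_class_pullback[a Ga hE] _ hD]] :=
    comeager_generic_tuple (D := D) com SK.
  apply: contrapT => nU; apply: nT; exists T, w; split=> // U UK TU.
  by apply: contrapT => na; apply: nU; exists U.
have [U [_ Uh nU]] := hD (map a B).
by apply: nU; exists a; split=> //; rewrite -hE.
Qed.

Lemma WAP_of_comeager g : comeager (diagonal_class g) -> WAP mm G n.
Proof.
move=> com S SK; have [B SB] := inK_generators SK.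
have [T [w [TK ST Tw]]] := locally_dense_conjugates B com SK.
exists T, (graph id); split=> //.
  by apply: embedding_graph; [exact: subgroup_id|move=> i [x y] /ST].
(* If [f] in [G] extends [chi], then [pullback f X] lies above [T] and embeds into [g] by some [a]
   with values [w] on [B]. So [a] after the inverse of [f] embeds [X] into [g], and its composite
   with [chi] is [a] on [S]. *)
have retract X chi : inK mm G X -> embedding mm G chi T X ->
    exists a c : M -> M, [/\ G a, G c, map a B = w,
      tuple_le X (pullback c (graphs g)) &
      forall x y, zdefs S x ->
        (graph c \; (chi \; graph id))%relation (x, y) <-> y = a x].
  move=> XK /embedding_extension[f [Gf chif TX chix]].
  have [f' [Gf' ff' f'f]] := subgroup_inv hG Gf.
  have [|a [Ga Xa aw]] := Tw (pullback f X) _ TX; first exact: pullback_inK.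
  exists a, (a \o f'); split=> //; first exact: subgroup_comp.
    by rewrite -[X](pullbackK _ f'f); exact: (pullback_le Xa).
  move=> x y Sx; split.
    move=> [z [u /= ux uz] zy].
    have {}ux : u = x := ux; have zf : z = f u := chif _ uz.
    have {}zy : y = a (f' z) := zy.
    by rewrite zy zf ux ff'.
  move=> ->; exists (f x); last by rewrite /graph /= ff'.
  by exists x => //; apply: chix; exact: zdefs_le ST _ Sx.
move=> U V phi psi UK VK /(retract _ _ UK)[a [c [Ga Gc aw Uc phiE]]].
move=> /(retract _ _ VK)[b [d [Gb Gd bw Vd psiE]]].
have [W [WK UW VW]] := joint_restriction Gc Gd UK VK Uc Vd.
exists W, (graph c), (graph d); split=> //; do ?exact: embedding_graph.
(* Equal values on [B] force [a] and [b] to agree on all of [S], so the two composites coincide. *)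
have ab : {in B, a =1 b} by apply/eq_in_map; rewrite aw bw.
move=> x Sx y; rewrite phiE // psiE //.
by rewrite (eq_generated hGop Ga Gb ab (SB _ Sx)).
Qed.

End AmalgamationOfComeager.

Theorem theorem3p10 (R : realType) (L : language) (M : countType)
    (mm : structure L M) (G : set (selfmaps M)) (n : nat)
    (hG : perm_group G) (hGop : preserves_operations mm G)
    (hpolish : polish R G) (hn : (1 <= n)%N) :
  [<-> JEP mm G n /\ WAP mm G n;
       exists Phi : 'I_n -> G, weakly_injective mm G (graphs Phi);
       exists Phi : 'I_n -> G, odd_wins_BM mm G (graphs Phi);
       exists g : 'I_n -> G, comeager (diagonal_class g)].
Proof.
have [_ hcm] := hpolish; tfae.
- move=> [jep wap].
  exact: (weakly_injective_of_amalgamation hG hGop hcm jep wap).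
- move=> [Phi inj]; exists Phi.
  exact: (odd_wins_of_weakly_injective hG hGop hcm hn inj).
- move=> [Phi win]; exists Phi.
  exact: (comeager_of_odd_wins hG hGop hn win).
- move=> [g com]; split; first exact: (JEP_of_comeager hG hGop hcm com).
  exact: (WAP_of_comeager hG hGop hcm com).
Qed.
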